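(* Let $f$ be a slice regular function on $\mathbb{B}$ with convex image $f(\mathbb{B})\subset\mathbb{H}$ and $f'(0)=1$. Then $f(\mathbb{B})$ contains an open ball centered at $f(0)$ of radius $1/2$. Moreover, the constant $1/2$ is optimal (it cannot be replaced by a larger constant valid for all such $f$).
   Context: $\mathbb{H}\cong\mathbb{R}^4$ denotes the quaternions, $\mathbb{B}=\{q\in\mathbb{H}:|q|<1\}$, $\mathbb{S}=\{q\in\mathbb{H}:q^2=-1\}$; for $I\in\mathbb{S}$, $\mathbb{C}_I=\mathbb{R}\oplus I\mathbb{R}$ and $\mathbb{B}_I=\mathbb{B}\cap\mathbb{C}_I$. A function $f:\mathbb{B}\to\mathbb{H}$ is (left) slice regular if for every $I\in\mathbb{S}$ the restriction $f_I=f|_{\mathbb{B}_I}$ has continuous partial derivatives and $\frac12\left(\frac{\partial}{\partial x}+I\frac{\partial}{\partial y}\right)f_I(x+yI)=0$ on $\mathbb{B}_I$; equivalently $f(q)=\sum_{n\ge0}q^na_n$ on $\mathbb{B}$ with $a_n\in\mathbb{H}$. Its slice derivative is $f'(x+yI)=\frac12\left(\frac{\partial}{\partial x}-I\frac{\partial}{\partial y}\right)f_I(x+yI)$, i.e. $f'(q)=\sum_{n\ge1}q^{n-1}na_n$. *)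

(* Defs.v *)
From Stdlib Require Import Reals Lra.
From Coquelicot Require Import Coquelicot.
Open Scope R_scope.

(* [(a, b, c, d)] is the quaternion a + b i + c j + d k.  The additive group,
   the real vector space structure and the topology on [quat] are the ones
   Coquelicot infers for the product [R * R * R * R]. *)
Definition quat : Type := (R * R * R * R)%type.

Declare Scope quat_scope.
Delimit Scope quat_scope with H.
Bind Scope quat_scope with quat.

Definition RtoH (x : R) : quat := (x, 0, 0, 0).

Definition Hplus (p q : quat) : quat := plus p q.
Definition Hminus (p q : quat) : quat := minus p q.
Definition Hscal (t : R) (q : quat) : quat := scal t q.

Definition Hmult (p q : quat) : quat :=
  let '(a1, b1, c1, d1) := p in
  let '(a2, b2, c2, d2) := q in
  (a1 * a2 - b1 * b2 - c1 * c2 - d1 * d2,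
   a1 * b2 + b1 * a2 + c1 * d2 - d1 * c2,
   a1 * c2 - b1 * d2 + c1 * a2 + d1 * b2,
   a1 * d2 + b1 * c2 - c1 * b2 + d1 * a2).

Infix "+" := Hplus : quat_scope.
Infix "-" := Hminus : quat_scope.
Infix "*" := Hmult : quat_scope.

Definition Hnorm (q : quat) : R :=
  let '(a, b, c, d) := q in sqrt (a ^ 2 + b ^ 2 + c ^ 2 + d ^ 2).

(* Coquelicot's [ball] on a product is a ball for the sup distance, hence the
   separate definition; its [norm] is however the Euclidean one. *)
Definition Hball (c : quat) (r : R) (q : quat) : Prop := Hnorm (q - c) < r.

Definition unit_ball (q : quat) : Prop := Hnorm q < 1.

Lemma Hnorm_norm (q : quat) : Hnorm q = norm q.
Proof.
destruct q as [[[a b] c] d]; unfold norm; simpl; unfold prod_norm; simpl.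
unfold norm; simpl; unfold prod_norm; simpl.
unfold norm; simpl; unfold prod_norm, norm; simpl; unfold abs; simpl.
assert (sq : forall x, Rabs x * (Rabs x * 1) = x * x).
{ intros x; rewrite Rmult_1_r, <- Rabs_mult; apply Rabs_right; nra. }
assert (ss : forall x, 0 <= x -> sqrt x * (sqrt x * 1) = x).
{ intros x hx; rewrite Rmult_1_r; now apply sqrt_sqrt. }
rewrite !sq, !ss; try (rewrite ?ss; nra).
f_equal; ring.
Qed.

Definition imag_unit (I : quat) : Prop := (I * I)%H = RtoH (-1).

Definition slice_pt (I : quat) (x y : R) : quat := (RtoH x + Hscal y I)%H.

Definition is_slice_dx (f : quat -> quat) (I : quat) (x y : R) (l : quat)
  : Prop := is_derive (fun t : R => f (slice_pt I t y) : quat) x l.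

Definition is_slice_dy (f : quat -> quat) (I : quat) (x y : R) (l : quat)
  : Prop := is_derive (fun t : R => f (slice_pt I x t) : quat) y l.

(* A function on the unit ball is represented by a total function whose values
   outside the ball are irrelevant.  [fx] and [fy] are the partial derivatives
   of the restriction of [f] to the slice C_I. *)
Definition slice_regular (f : quat -> quat) : Prop :=
  forall I : quat, imag_unit I ->
  exists fx fy : R * R -> quat,
  forall x y : R, unit_ball (slice_pt I x y) ->
    is_slice_dx f I x y (fx (x, y)) /\
    is_slice_dy f I x y (fy (x, y)) /\
    continuous fx (x, y) /\
    continuous fy (x, y) /\
    Hscal (1 / 2) (fx (x, y) + I * fy (x, y))%H = RtoH 0.

(* [f'(q) = l].  A real [q] lies on every slice, and then the formula is
   required to give [l] on each of them. *)
Definition is_slice_derive (f : quat -> quat) (q l : quat) : Prop :=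
  forall (I : quat) (x y : R), imag_unit I -> q = slice_pt I x y ->
  exists fx fy : quat,
    is_slice_dx f I x y fx /\
    is_slice_dy f I x y fy /\
    l = Hscal (1 / 2) (fx - I * fy)%H.

Definition image (f : quat -> quat) (D : quat -> Prop) (w : quat) : Prop :=
  exists q : quat, D q /\ f q = w.

Definition convex_set (A : quat -> Prop) : Prop :=
  forall (p q : quat) (t : R), A p -> A q -> 0 <= t <= 1 ->
  A (Hscal (1 - t) p + Hscal t q)%H.

(* Main.v *)
(* If [w] is not in the convex set [f(B)], a hyperplane through [w] with unit
   normal [n] bounds [f(B)]: [<n, f - w> >= 0].  Choose [I] with [n] in the slice
   [C_I].  On that slice [<n, f - w>] is the real part of a holomorphic function
   [G] whose derivative at 0 is the conjugate of [n], and Caratheodory's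
   inequality [|G'(0)| <= 2 Re G(0)] gives [1 <= 2 <n, f(0) - w> <= 2 |f(0) - w|].
   The function [q (1 - q)^-1], whose image is the half space [Re w > -1/2],
   shows that 1/2 is optimal. *)

Require Import Defs.
From Stdlib Require Import Reals Lra Psatz Classical.
From Coquelicot Require Import Coquelicot.
Open Scope R_scope.

(** * Separation of a point from a convex set *)

(** The image of [f] is convex but not known to be open or closed, so only a weak supporting
    inequality can be hoped for; it suffices because the ball of radius 1/2 is open. In finite
    dimension such a weak separation exists for every convex set and every point outside it, and it
    is built one real coordinate at a time along the nested product that defines [quat]. On any
    slice C_I, [<n, f>] and [<I n, f>] form a conjugate harmonic pair. What singles out the slice
    containing [n] is the gradient of [<n, f>] at 0: it is the projection of [n] to C_I, and it has
    full length 1 only when [n] lies in C_I. Regularity is given as C^1 with Cauchy-Riemann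
    equations, and Caratheodory's inequality is derived from that directly, without power series: it
    compares the harmonics of order 0 and 1 on circles, computed by differentiating under the
    integral and integrating by parts. *)

Section Separation.

Variable V : ModuleSpace R_AbsRing.

Definition convex_in (A : V -> Prop) : Prop :=
  forall (p q : V) (t : R), A p -> A q -> 0 <= t <= 1 ->
  A (plus (scal (1 - t) p) (scal t q)).

Definition linear_form (l : V -> R) : Prop :=
  (forall p q, l (plus p q) = l p + l q) /\ (forall t p, l (scal t p) = t * l p).

(** The inequality is weak because [w] may be a boundary point of [A]; requiring [l e <> 0] excludes
    the zero form, which would satisfy it trivially. *)
Definition point_separation : Prop :=
  forall (A : V -> Prop) (w : V), convex_in A -> ~ A w ->
  exists l, linear_form l /\ (exists e, l e <> 0) /\ forall a, A a -> l w <= l a.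

End Separation.

Arguments convex_in {V}.
Arguments linear_form {V}.

Lemma point_separation_R : point_separation R_ModuleSpace.
Proof.
intros A w cA nw.
assert (cross : forall a b, A a -> A b -> a < w < b -> False).
{ intros a b ha hb hw; apply nw.
  replace w with (plus (scal (1 - (w - a) / (b - a)) a) (scal ((w - a) / (b - a)) b)).
  - apply cA; trivial; split.
    + apply Rdiv_le_0_compat; lra.
    + apply Rle_div_l; lra.
  - unfold plus, scal; simpl; unfold mult; simpl; field; lra. }
destruct (classic (exists a, A a /\ a < w)) as [(a & ha & hw)|no].
- exists (fun x => - x); repeat split.
  + intros p q; unfold plus; simpl; ring.
  + intros t p; unfold scal; simpl; unfold mult; simpl; ring.
  + exists 1; lra.
  + intros b hb; destruct (Rle_or_lt b w); [lra|]; destruct (cross a b); trivial; lra.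
- exists (fun x => x); repeat split.
  + exists 1; lra.
  + intros b hb; destruct (Rle_or_lt w b); [lra|]; destruct no; now exists b.
Qed.

Lemma combination_pair (V : ModuleSpace R_AbsRing) (p q : V) (s t x y : R) :
  plus (scal s (p, x)) (scal t (q, y))
  = (plus (scal s p) (scal t q), s * x + t * y)
    :> prod_ModuleSpace R_AbsRing V R_ModuleSpace.
Proof. reflexivity. Qed.

(* Hahn-Banach step: separate the slice of [A] at the height of [w], then choose
   the slope [c] in the new direction between the constraints coming from the
   points of [A] below and above that height.  When one of these sides is
   empty, the height itself separates. *)
Lemma point_separation_prod (V : ModuleSpace R_AbsRing) :
  point_separation V -> point_separation (prod_ModuleSpace R_AbsRing V R_ModuleSpace).
Proof.
intros sV A [w h] cA nw; change R in h.
destruct (classic (exists a, A a /\ snd a < h)) as [lo|no].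
2: { exists (fun x => snd x);
  refine (conj (conj (fun _ _ => eq_refl) (fun _ _ => eq_refl)) (conj _ _)).
  + exists (zero, 1); simpl; lra.
  + intros a ha; destruct (Rle_or_lt h (snd a)); [assumption|]; destruct no; now exists a. }
destruct (classic (exists a, A a /\ h < snd a)) as [hi|no].
2: { exists (fun x => - snd x); repeat split.
  + intros p q; unfold plus; simpl; unfold plus; simpl; ring.
  + intros t p; unfold scal; simpl; unfold scal; simpl; unfold mult; simpl; ring.
  + exists (zero, 1); simpl; lra.
  + intros a ha; destruct (Rle_or_lt (snd a) h) as [k|]; [now apply Ropp_le_contravar|].
    destruct no; now exists a. }
assert (cA0 : convex_in (fun p : V => A (p, h))).
{ intros p q t hp hq ht; generalize (cA _ _ t hp hq ht); rewrite combination_pair.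
  now replace ((1 - t) * h + t * h) with h by ring. }
destruct (sV _ w cA0 nw) as (l & [lp ls] & (e & he) & sep).
(* The segment from [a] to [b] meets height [h] at parameter [(h - x) / (y - x)]; [sep] at that
   point, cleared of denominators, orders the two slopes. *)
assert (cons : forall a b, A a -> A b -> snd a < h -> h < snd b ->
  (l w - l (fst b)) / (snd b - h) <= (l (fst a) - l w) / (h - snd a)).
{ intros [a x] [b y] ha hb hx hy; simpl in *.
  assert (m := cA (a, x) (b, y) ((h - x) / (y - x)) ha hb).
  assert (hm : 0 <= (h - x) / (y - x) <= 1).
  { split; [apply Rdiv_le_0_compat; lra | apply Rle_div_l; lra]. }
  specialize (m hm).
  rewrite combination_pair in m.
  replace ((1 - (h - x) / (y - x)) * x + (h - x) / (y - x) * y) with h in m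
    by (field; lra).
  apply sep in m; rewrite lp, !ls in m.
  apply Rle_div_l; [lra|].
  replace ((l a - l w) / (h - x) * (y - h)) with ((l a - l w) * (y - h) / (h - x))
    by (field; lra).
  apply Rle_div_r; [lra|].
  replace ((1 - (h - x) / (y - x)) * l a + (h - x) / (y - x) * l b)
    with (((y - h) * l a + (h - x) * l b) / (y - x)) in m by (field; lra).
  apply Rle_div_r in m; [nra | lra]. }
destruct lo as (a0 & ha0 & hlo); destruct hi as (b0 & hb0 & hhi).
(* Points above [h] bound the slope from below, points below [h] bound it from above. [c] is the
   supremum of the lower bounds; [a0] makes their set bounded and [b0] makes it nonempty. *)
destruct (completeness (fun s => exists b, A b /\ h < snd b /\
   s = (l w - l (fst b)) / (snd b - h))) as (c & ub & lub).
{ exists ((l (fst a0) - l w) / (h - snd a0)); intros s (b & hb & hy & ->); now apply cons. }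
{ eexists; exists b0; repeat split; trivial. }
exists (fun x => l (fst x) + c * snd x); repeat split.
- intros [p x] [q y]; unfold plus; simpl; rewrite lp; unfold plus; simpl; ring.
- intros t [p x]; unfold scal; simpl; rewrite ls; unfold scal; simpl; unfold mult; simpl; ring.
- exists (e, 0); simpl; lra.
- intros [a x] ha; simpl.
  destruct (Rtotal_order x h) as [hx | [-> | hx]].
  + assert (k : c <= (l a - l w) / (h - x)).
    { apply lub; intros s (b & hb & hy & ->); now apply (cons (a, x)). }
    apply Rle_div_r in k; lra.
  + assert (k := sep a ha); lra.
  + assert (k : (l w - l a) / (x - h) <= c) by (apply ub; now exists (a, x)).
    apply Rle_div_l in k; lra.
Qed.

Definition Hdot (p q : quat) : R :=
  let '(a1, b1, c1, d1) := p in
  let '(a2, b2, c2, d2) := q in a1 * a2 + b1 * b2 + c1 * c2 + d1 * d2.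

(** Three extension steps lead from R to dimension 4. The form obtained is the dot product with its
    values on the standard basis, a nonzero vector that can be normalised. *)
Lemma convex_separation (A : quat -> Prop) (w : quat) : convex_set A -> ~ A w ->
  exists n : quat, Hdot n n = 1 /\ forall a, A a -> Hdot n w <= Hdot n a.
Proof.
intros cA nw.
destruct (point_separation_prod _ (point_separation_prod _ (point_separation_prod _
   point_separation_R)) A w cA nw) as (l & [lp ls] & (e & he) & sep).
set (n0 := l (1, 0, 0, 0)); set (n1 := l (0, 1, 0, 0)).
set (n2 := l (0, 0, 1, 0)); set (n3 := l (0, 0, 0, 1)).
assert (le : forall q : quat, l q = Hdot (n0, n1, n2, n3) q).
{ intros [[[a b] c] d].
  transitivity (l (plus (scal a ((1, 0, 0, 0) : quat)) (plus (scal b ((0, 1, 0, 0) : quat))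
    (plus (scal c ((0, 0, 1, 0) : quat)) (scal d ((0, 0, 0, 1) : quat)))))).
  - f_equal; symmetry.
    transitivity ((a * 1 + (b * 0 + (c * 0 + d * 0)), a * 0 + (b * 1 + (c * 0 + d * 0)),
      a * 0 + (b * 0 + (c * 1 + d * 0)), a * 0 + (b * 0 + (c * 0 + d * 1))) : quat);
      [reflexivity | repeat f_equal; ring].
  - rewrite !lp, !ls; fold n0 n1 n2 n3; simpl; ring. }
clearbody n0 n1 n2 n3.
assert (pos : 0 < n0 ^ 2 + n1 ^ 2 + n2 ^ 2 + n3 ^ 2).
{ destruct (Rle_lt_dec (n0 ^ 2 + n1 ^ 2 + n2 ^ 2 + n3 ^ 2) 0) as [h|]; trivial.
  destruct he; rewrite le; destruct e as [[[a b] c] d]; simpl.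
  assert (n0 = 0) by nra; assert (n1 = 0) by nra.
  assert (n2 = 0) by nra; assert (n3 = 0) by nra; subst; ring. }
set (m := sqrt (n0 ^ 2 + n1 ^ 2 + n2 ^ 2 + n3 ^ 2)).
assert (mp : 0 < m) by now apply sqrt_lt_R0.
assert (mm : m * m = n0 ^ 2 + n1 ^ 2 + n2 ^ 2 + n3 ^ 2) by (apply sqrt_sqrt; lra).
assert (sc : forall q, Hdot (n0 / m, n1 / m, n2 / m, n3 / m) q = / m * l q).
{ intros q; rewrite le; destruct q as [[[a b] c] d]; simpl; field; lra. }
exists (n0 / m, n1 / m, n2 / m, n3 / m); split.
- simpl; replace (n0 / m * (n0 / m) + n1 / m * (n1 / m) + n2 / m * (n2 / m) + n3 / m * (n3 / m))
    with ((n0 ^ 2 + n1 ^ 2 + n2 ^ 2 + n3 ^ 2) / (m * m)) by (field; lra).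
  rewrite mm; field; lra.
- intros a ha; rewrite !sc; apply Rmult_le_compat_l.
  + left; now apply Rinv_0_lt_compat.
  + now apply sep.
Qed.

(** * Integrals over circles *)

(** The Cauchy-Riemann equations are built in by writing the partial derivatives of [v] in terms of
    those of [u]: [u + i v] is holomorphic on the unit disc. *)
Definition cauchy_riemann (u v ux uy : R -> R -> R) : Prop :=
  forall x y, x ^ 2 + y ^ 2 < 1 ->
    is_derive (fun t => u t y) x (ux x y) /\
    is_derive (fun t => u x t) y (uy x y) /\
    is_derive (fun t => v t y) x (- uy x y) /\
    is_derive (fun t => v x t) y (ux x y) /\
    continuous (fun z : R * R => ux (fst z) (snd z)) (x, y) /\
    continuous (fun z : R * R => uy (fst z) (snd z)) (x, y).

(** This is multiplication of [u + i v] by [-i]; it carries every result about [u] over to [v]. *)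
Lemma cauchy_riemann_rotate (u v ux uy : R -> R -> R) :
  cauchy_riemann u v ux uy ->
  cauchy_riemann v (fun x y => - u x y) (fun x y => - uy x y) ux.
Proof.
intros H x y hxy; destruct (H x y hxy) as (h1 & h2 & h3 & h4 & h5 & h6).
refine (conj h3 (conj h4 (conj _ (conj _ (conj _ h5))))).
- exact (is_derive_opp (fun t => u t y) x _ h1).
- exact (is_derive_opp (fun t => u x t) y _ h2).
- apply (continuous_opp (fun z : R * R => uy (fst z) (snd z))); assumption.
Qed.

Lemma continuous_fst2 (x y : R) : continuous (fun z : R * R => fst z) (x, y).
Proof. apply continuous_fst. Qed.

Lemma continuous_snd2 (x y : R) : continuous (fun z : R * R => snd z) (x, y).
Proof. apply continuous_snd. Qed.

Lemma continuous_Rmult {U : UniformSpace} (f g : U -> R) (x : U) :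
  continuous f x -> continuous g x -> continuous (fun y => f y * g y) x.
Proof. apply (continuous_mult (K := R_AbsRing)). Qed.

Lemma continuous_Rplus {U : UniformSpace} (f g : U -> R) (x : U) :
  continuous f x -> continuous g x -> continuous (fun y => f y + g y) x.
Proof. apply (continuous_plus (V := R_NormedModule)). Qed.

Lemma disc_open (x y : R) : x ^ 2 + y ^ 2 < 1 ->
  locally ((x, y) : R * R) (fun z : R * R => fst z ^ 2 + snd z ^ 2 < 1).
Proof.
intros h.
assert (c : continuous (fun z : R * R => fst z * fst z + snd z * snd z) (x, y)).
{ apply continuous_Rplus; apply continuous_Rmult;
    first [apply continuous_fst2 | apply continuous_snd2]. }
assert (o : locally (x * x + y * y) (fun s => s < 1)) by (apply open_lt; nra).
refine (filter_imp (fun z : R * R => fst z * fst z + snd z * snd z < 1) _ _ (c _ o)).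
intros z hz; nra.
Qed.

(** Total differentiability is what the chain rule in polar coordinates requires. *)
Lemma C1_differentiable (u ux uy : R -> R -> R) (x y : R) :
  (forall x y, x ^ 2 + y ^ 2 < 1 ->
    is_derive (fun t => u t y) x (ux x y) /\
    is_derive (fun t => u x t) y (uy x y) /\
    continuous (fun z : R * R => ux (fst z) (snd z)) (x, y)) ->
  x ^ 2 + y ^ 2 < 1 -> differentiable_pt_lim u x y (ux x y) (uy x y).
Proof.
intros H hxy; destruct (H x y hxy) as (h1 & h2 & h5).
apply filterdiff_differentiable_pt_lim.
refine (is_derive_filterdiff u x y ux (uy x y) _ h2 h5).
generalize (disc_open x y hxy); apply filter_imp; intros [a b] hab.
now apply H.
Qed.

Section Circle.

Variables u v ux uy : R -> R -> R.
Hypothesis CR : cauchy_riemann u v ux uy.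

(** The radial derivative of [u]. By the Cauchy-Riemann equations, [r] times it is the angular
    derivative of [v]. *)
Let radial (r t : R) : R :=
  ux (r * cos t) (r * sin t) * cos t + uy (r * cos t) (r * sin t) * sin t.

Lemma polar_in_disc (r t : R) :
  -1 < r < 1 -> (r * cos t) ^ 2 + (r * sin t) ^ 2 < 1.
Proof.
intros hr; generalize (sin2_cos2 t); unfold Rsqr; intros e.
replace ((r * cos t) ^ 2 + (r * sin t) ^ 2)
  with (r ^ 2 * (sin t * sin t + cos t * cos t)) by ring.
rewrite e; nra.
Qed.

Lemma u_differentiable x y : x ^ 2 + y ^ 2 < 1 ->
  differentiable_pt_lim u x y (ux x y) (uy x y).
Proof.
apply C1_differentiable; intros a b hab.
now destruct (CR a b hab) as (h1 & h2 & _ & _ & h5 & _).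
Qed.

Lemma v_differentiable x y : x ^ 2 + y ^ 2 < 1 ->
  differentiable_pt_lim v x y (- uy x y) (ux x y).
Proof.
apply (C1_differentiable v (fun x y => - uy x y) ux); intros a b hab.
now destruct (cauchy_riemann_rotate _ _ _ _ CR a b hab)
  as (h1 & h2 & _ & _ & h5 & _).
Qed.

Lemma is_derive_radius (r t : R) : -1 < r < 1 ->
  is_derive (fun r => u (r * cos t) (r * sin t)) r (radial r t).
Proof.
intros hr; apply is_derive_Reals.
apply (derivable_pt_lim_comp_2d u (fun r => r * cos t) (fun r => r * sin t)).
- now apply u_differentiable, polar_in_disc.
- apply is_derive_Reals; auto_derive; trivial; ring.
- apply is_derive_Reals; auto_derive; trivial; ring.
Qed.

Lemma is_derive_angle (r t : R) : -1 < r < 1 ->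
  is_derive (fun t => v (r * cos t) (r * sin t)) t (r * radial r t).
Proof.
intros hr; apply is_derive_Reals.
replace (r * radial r t) with
  (- uy (r * cos t) (r * sin t) * (r * - sin t)
   + ux (r * cos t) (r * sin t) * (r * cos t))
  by (unfold radial; ring).
apply (derivable_pt_lim_comp_2d v (fun t => r * cos t) (fun t => r * sin t)).
- now apply v_differentiable, polar_in_disc.
- apply is_derive_Reals; auto_derive; trivial; ring.
- apply is_derive_Reals; auto_derive; trivial; ring.
Qed.

Lemma continuous_circle (r t : R) : -1 < r < 1 ->
  continuous (fun t => u (r * cos t) (r * sin t)) t.
Proof.
intros hr; apply (ex_derive_continuous (K := R_AbsRing) (V := R_NormedModule)).
eexists; apply is_derive_Reals.
apply (derivable_pt_lim_comp_2d u (fun t => r * cos t) (fun t => r * sin t)).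
- now apply u_differentiable, polar_in_disc.
- apply is_derive_Reals; auto_derive; trivial.
- apply is_derive_Reals; auto_derive; trivial.
Qed.

Lemma continuous_comp_snd2 (g : R -> R) (r t : R) : continuous g t ->
  continuous (fun z : R * R => g (snd z)) (r, t).
Proof.
intros h; apply (continuous_comp (fun z : R * R => snd z) g);
  [apply continuous_snd2 | exact h].
Qed.

Lemma continuous_radial (r t : R) : -1 < r < 1 ->
  continuous (fun z : R * R => radial (fst z) (snd z)) (r, t).
Proof.
intros hr.
destruct (CR _ _ (polar_in_disc r t hr)) as (_ & _ & _ & _ & hx & hy).
assert (cc := continuous_comp_snd2 cos r t (continuous_cos t)).
assert (cs := continuous_comp_snd2 sin r t (continuous_sin t)).
unfold radial; apply continuous_Rplus; apply continuous_Rmult; trivial.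
- apply (continuous_comp_2 (fun z : R * R => fst z * cos (snd z))
    (fun z : R * R => fst z * sin (snd z)) ux); trivial;
  apply continuous_Rmult; trivial; apply continuous_fst2.
- apply (continuous_comp_2 (fun z : R * R => fst z * cos (snd z))
    (fun z : R * R => fst z * sin (snd z)) uy); trivial;
  apply continuous_Rmult; trivial; apply continuous_fst2.
Qed.

(** For [k] equal to 1, [cos] or [sin] this is, up to normalisation, a Fourier coefficient of [w] on
    the circle of radius [r]. *)
Definition circle_int (w : R -> R -> R) (k : R -> R) (r : R) : R :=
  RInt (fun t => w (r * cos t) (r * sin t) * k t) 0 (2 * PI).

Lemma ex_circle_int (k : R -> R) (r : R) : -1 < r < 1 ->
  (forall t, continuous k t) ->
  ex_RInt (fun t => u (r * cos t) (r * sin t) * k t) 0 (2 * PI).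
Proof.
intros hr hk; apply (ex_RInt_continuous (V := R_CompleteNormedModule)).
intros t _; apply continuous_Rmult; trivial; now apply continuous_circle.
Qed.

Lemma is_derive_circle_int (k : R -> R) (r : R) : -1 < r < 1 ->
  (forall t, continuous k t) ->
  is_derive (circle_int u k) r (RInt (fun t => radial r t * k t) 0 (2 * PI)).
Proof.
intros hr hk.
assert (nb : locally r (fun s => -1 < s < 1)).
{ apply (open_and (fun s => -1 < s) (fun s => s < 1));
    [apply open_gt | apply open_lt | exact hr]. }
assert (d : forall s t, -1 < s < 1 ->
  is_derive (fun s => u (s * cos t) (s * sin t) * k t) s (radial s t * k t)).
{ intros s t hs; generalize (is_derive_radius s t hs); intros e.
  apply (is_derive_ext (fun s => scal (u (s * cos t) (s * sin t)) (k t)));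
    [reflexivity|].
  exact (is_derive_scal_l _ _ _ (k t) e). }
rewrite <- (RInt_ext (fun t => Derive (fun s => u (s * cos t) (s * sin t) * k t) r)).
2: { intros t _; apply is_derive_unique; now apply d. }
apply is_derive_RInt_param.
- generalize nb; apply filter_imp; intros s hs t _; eexists; now apply d.
- intros t _; apply continuity_2d_pt_filterlim.
  change (continuous (fun z : R * R =>
    Derive (fun s => u (s * cos (snd z)) (s * sin (snd z)) * k (snd z)) (fst z)) (r, t)).
  apply (continuous_ext_loc _ (fun z : R * R => radial (fst z) (snd z) * k (snd z))).
  + assert (nb2 : locally ((r, t) : R * R) (fun z : R * R => -1 < fst z < 1)).
    { exact (continuous_fst2 r t _ nb). }
    revert nb2; apply filter_imp; intros [s p] hs; symmetry.
    apply is_derive_unique; now apply d.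
  + apply continuous_Rmult; [now apply continuous_radial|].
    now apply continuous_comp_snd2.
- generalize nb; apply filter_imp; intros s hs; now apply ex_circle_int.
Qed.

(** The derivative of [v k] along the circle is [r radial k + v k']; its integral over a full turn
    vanishes by periodicity. *)
Lemma circle_int_by_parts (k k' : R -> R) (r : R) : -1 < r < 1 ->
  (forall t, is_derive k t (k' t)) -> (forall t, continuous k' t) ->
  k (2 * PI) = k 0 ->
  r * RInt (fun t => radial r t * k t) 0 (2 * PI) = - circle_int v k' r.
Proof.
intros hr hk hk' per.
assert (ck : forall t, continuous k t).
{ intros t; apply (ex_derive_continuous (K := R_AbsRing) (V := R_NormedModule)).
  now exists (k' t). }
assert (cr : forall t, continuous (fun t => radial r t * k t) t).
{ intros t; apply continuous_Rmult; trivial.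
  apply (continuous_comp_2 (fun _ => r) (fun t => t) radial);
    [apply continuous_const | apply continuous_id | now apply continuous_radial]. }
assert (cv : forall t, continuous (fun t => v (r * cos t) (r * sin t) * k' t) t).
{ intros t; apply continuous_Rmult; trivial.
  apply (ex_derive_continuous (K := R_AbsRing) (V := R_NormedModule)).
  eexists; now apply is_derive_angle. }
assert (ftc : is_RInt (fun t => r * (radial r t * k t) + v (r * cos t) (r * sin t) * k' t)
   0 (2 * PI) (minus (v (r * cos (2 * PI)) (r * sin (2 * PI)) * k (2 * PI))
                     (v (r * cos 0) (r * sin 0) * k 0))).
{ apply (is_RInt_derive (fun t => v (r * cos t) (r * sin t) * k t)).
  - intros t _.
    replace (r * (radial r t * k t) + v (r * cos t) (r * sin t) * k' t)
      with (plus (mult (r * radial r t) (k t)) (mult (v (r * cos t) (r * sin t)) (k' t)))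
      by (unfold plus, mult; simpl; ring).
    apply (is_derive_mult (fun t => v (r * cos t) (r * sin t)) k t).
    + now apply is_derive_angle.
    + apply hk.
    + intros; apply Rmult_comm.
  - intros t _; apply continuous_Rplus; trivial.
    apply continuous_Rmult; [apply continuous_const | apply cr]. }
rewrite cos_2PI, sin_2PI, cos_0, sin_0, per, minus_eq_zero in ftc.
apply (is_RInt_unique (V := R_CompleteNormedModule)) in ftc.
assert (e1 : ex_RInt (fun t => radial r t * k t) 0 (2 * PI)).
{ apply (ex_RInt_continuous (V := R_CompleteNormedModule)); intros; apply cr. }
assert (e2 : ex_RInt (fun t => v (r * cos t) (r * sin t) * k' t) 0 (2 * PI)).
{ apply (ex_RInt_continuous (V := R_CompleteNormedModule)); intros; apply cv. }
assert (s := RInt_plus (V := R_CompleteNormedModule) _ _ 0 (2 * PI)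
  (ex_RInt_scal _ _ _ r e1) e2).
assert (s' := RInt_scal (V := R_CompleteNormedModule) _ 0 (2 * PI) r e1).
unfold plus, scal, zero in s, s', ftc; simpl in s, s', ftc.
unfold mult in s, s'; simpl in s, s'.
unfold circle_int; lra.
Qed.

End Circle.

(** * Harmonics of order 0 and 1, and Caratheodory's inequality *)

Lemma continuous_combination (a b t : R) : continuous (fun t => a * cos t + b * sin t) t.
Proof.
apply (ex_derive_continuous (K := R_AbsRing) (V := R_NormedModule)); auto_derive; trivial.
Qed.

Lemma eq_of_derive_zero (g : R -> R) (a b : R) : a <= b ->
  (forall t, a <= t <= b -> is_derive g t 0) -> g a = g b.
Proof.
intros [h | ->] d; trivial.
now apply (eq_is_derive (V := R_NormedModule) g).
Qed.

(* With [k = a cos + b sin] and [m = a sin - b cos], the integrals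
   [F r] of [u k] and [G r] of [v m] over the circle of radius [r] satisfy
   [r F' = G] and [r G' = F], so [r (F - G)] and then [F / r] are constant. *)
Lemma circle_int_first_harmonic (u v ux uy : R -> R -> R) (a b r : R) :
  cauchy_riemann u v ux uy -> 0 < r < 1 ->
  circle_int u (fun t => a * cos t + b * sin t) r = r * (PI * (a * ux 0 0 + b * uy 0 0)).
Proof.
intros CR hr.
set (k := fun t => a * cos t + b * sin t).
set (m := fun t => a * sin t - b * cos t).
set (F := circle_int u k); set (G := circle_int v m).
assert (ck : forall t, continuous k t) by (intros; apply continuous_combination).
assert (cm : forall t, continuous m t).
{ intros t; apply (ex_derive_continuous (K := R_AbsRing) (V := R_NormedModule)).
  unfold m; auto_derive; trivial. }
assert (dk : forall t, is_derive k t (- m t)).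
{ intros t; unfold k, m; auto_derive; trivial; ring. }
assert (dm : forall t, is_derive m t (k t)).
{ intros t; unfold k, m; auto_derive; trivial; ring. }
assert (pk : k (2 * PI) = k 0).
{ unfold k; rewrite cos_2PI, sin_2PI, cos_0, sin_0; ring. }
assert (pm : m (2 * PI) = m 0).
{ unfold m; rewrite cos_2PI, sin_2PI, cos_0, sin_0; ring. }
assert (CR' := cauchy_riemann_rotate _ _ _ _ CR).
assert (neg : forall (w : R -> R -> R) (l : R -> R) s,
  ex_RInt (fun t => w (s * cos t) (s * sin t) * l t) 0 (2 * PI) ->
  RInt (fun t => - (w (s * cos t) (s * sin t) * l t)) 0 (2 * PI) = - circle_int w l s).
{ intros w l s e; apply (RInt_opp (V := R_CompleteNormedModule)); exact e. }
assert (dF : forall s, -1 < s < 1 -> exists l, is_derive F s l /\ s * l = G s).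
{ intros s hs; eexists; split; [now apply (is_derive_circle_int _ _ _ _ CR)|].
  rewrite (circle_int_by_parts _ _ _ _ CR k (fun t => - m t)); trivial.
  - unfold G; rewrite <- (Ropp_involutive (circle_int v m s)); f_equal.
    rewrite <- neg.
    + apply RInt_ext; intros; apply Ropp_mult_distr_r_reverse.
    + now apply (ex_circle_int _ _ _ _ CR').
  - intros t; apply (continuous_opp m); apply cm. }
assert (dG : forall s, -1 < s < 1 -> exists l, is_derive G s l /\ s * l = F s).
{ intros s hs; eexists; split; [now apply (is_derive_circle_int _ _ _ _ CR')|].
  rewrite (circle_int_by_parts _ _ _ _ CR' m k); trivial.
  unfold F; rewrite <- (Ropp_involutive (circle_int u k s)); f_equal.
  rewrite <- neg.
  - apply RInt_ext; intros; apply Ropp_mult_distr_l_reverse.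
  - now apply (ex_circle_int _ _ _ _ CR). }
assert (FG : forall s, 0 < s < 1 -> F s = G s).
{ intros s hs.
  assert (z : 0 * (F 0 - G 0) = s * (F s - G s)).
  { apply (eq_of_derive_zero (fun s => s * (F s - G s))); [lra|].
    intros t ht; destruct (dF t) as (l & hl & el); [lra|].
    destruct (dG t) as (l' & hl' & el'); [lra|].
    auto_derive; [split; [now exists l | split; [now exists l' | trivial]]|].
    assert (uF : Derive (fun x => F x) t = l) by now apply is_derive_unique.
    assert (uG : Derive (fun x => G x) t = l') by now apply is_derive_unique.
    rewrite uF, uG; lra. }
  assert (s * (F s - G s) = 0) by lra.
  apply Rmult_integral in H; lra. }
assert (ratio : forall s, 0 < s <= r -> F s / s = F r / r).
{ intros s hs; apply (eq_of_derive_zero (fun s => F s / s)); [lra|].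
  intros t ht; destruct (dF t) as (l & hl & el); [lra|].
  auto_derive; [repeat split; [now exists l | lra]|].
  assert (uF : Derive (fun x => F x) t = l) by now apply is_derive_unique.
  rewrite uF, (FG t), <- el by lra; field; lra. }
assert (F0 : F 0 = 0).
{ destruct (dG 0) as (l & _ & e); lra. }
assert (dF0 : is_derive F 0 (PI * (a * ux 0 0 + b * uy 0 0))).
{ assert (d := is_derive_circle_int _ _ _ _ CR k 0 ltac:(lra) ck); simpl in d.
  match type of d with is_derive _ _ ?s =>
    replace (PI * (a * ux 0 0 + b * uy 0 0)) with s; [exact d|] end.
  apply (is_RInt_unique (V := R_CompleteNormedModule)).
  set (A := ux 0 0); set (B := uy 0 0).
  (* At radius 0 the radial derivative is [A cos t + B sin t]; [P] is an antiderivative of its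
     product with [k], and only the terms in [t / 2] contribute over a full turn. *)
  set (P := fun t => A * a * ((t + sin t * cos t) / 2) + B * b * ((t - sin t * cos t) / 2)
     + (A * b + B * a) * (sin t * sin t / 2)).
  replace (PI * (a * A + b * B)) with (minus (P (2 * PI)) (P 0)).
  2: { unfold P, minus, plus, opp; simpl.
       rewrite cos_2PI, sin_2PI, cos_0, sin_0; field. }
  apply (is_RInt_ext (fun t => (A * cos t + B * sin t) * k t)).
  { intros t _; now rewrite !Rmult_0_l. }
  apply (is_RInt_derive P).
  - intros t _; unfold P, k; auto_derive; trivial.
    generalize (sin2_cos2 t); unfold Rsqr; intros e.
    assert (c2 : cos t * cos t = 1 - sin t * sin t) by lra.
    field [c2].
  - intros t _; apply continuous_Rmult; trivial; apply continuous_combination. }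
(* [F s / s] is constant on [(0, r]], and since [F 0 = 0] it is the difference quotient of [F] at 0.
   So the constant is [F'(0)]; [h] is a radius in this interval smaller than [delta]. *)
assert (lim : F r / r = PI * (a * ux 0 0 + b * uy 0 0)).
{ apply is_derive_Reals in dF0.
  set (L := PI * (a * ux 0 0 + b * uy 0 0)) in *.
  apply cond_eq; intros eps heps; destruct (dF0 eps heps) as (delta & hd).
  set (h := Rmin (r / 2) (delta / 2)).
  assert (hh : 0 < h) by (apply Rmin_pos; [lra | destruct delta; simpl; lra]).
  assert (h1 := Rmin_l (r / 2) (delta / 2)); assert (h2 := Rmin_r (r / 2) (delta / 2)).
  fold h in h1, h2; destruct delta as [delta hdelta]; simpl in *.
  specialize (hd h ltac:(lra)); rewrite Rplus_0_l, F0, Rminus_0_r in hd.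
  rewrite ratio in hd by lra; apply hd; rewrite Rabs_right; lra. }
fold F; rewrite <- lim; field; lra.
Qed.

(** The mean value property: integration by parts with a constant weight shows that the integral
    does not depend on the radius, and at radius 0 the integrand is constant. *)
Lemma circle_int_const (u v ux uy : R -> R -> R) (r : R) :
  cauchy_riemann u v ux uy -> 0 < r < 1 ->
  circle_int u (fun _ => 1) r = 2 * PI * u 0 0.
Proof.
intros CR hr.
transitivity (circle_int u (fun _ => 1) 0).
2: { unfold circle_int; rewrite (RInt_ext _ (fun _ => u 0 0)).
  - rewrite RInt_const; unfold scal; simpl; unfold mult; simpl; ring.
  - intros t _; rewrite !Rmult_0_l; apply Rmult_1_r. }
assert (c1 : forall t : R, continuous (fun _ : R => 1) t) by (intros; apply continuous_const).
assert (zero_int : RInt (fun _ => 0) 0 (2 * PI) = 0).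
{ rewrite RInt_const; unfold scal; simpl; unfold mult; simpl; ring. }
symmetry; apply eq_of_derive_zero; [lra|]; intros s hs.
assert (d := is_derive_circle_int _ _ _ _ CR _ s ltac:(lra) c1); simpl in d.
match type of d with is_derive _ _ ?l => replace 0 with l; [exact d|] end.
(* Integration by parts only gives [s] times the derivative. At [s = 0] the derivative is instead
   computed as the integral of a pure first harmonic, which has mean zero. *)
destruct (Rle_lt_or_eq_dec 0 s (proj1 hs)) as [pos | <-].
- assert (e : s * RInt (fun t => (ux (s * cos t) (s * sin t) * cos t
    + uy (s * cos t) (s * sin t) * sin t) * 1) 0 (2 * PI) = 0).
  { rewrite (circle_int_by_parts _ _ _ _ CR (fun _ => 1) (fun _ => 0)); trivial; try lra.
    - unfold circle_int; rewrite (RInt_ext _ (fun _ => 0)); [lra|].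
      intros; apply Rmult_0_r.
    - intros; apply (is_derive_const (V := R_NormedModule)).
    - intros; apply continuous_const. }
  apply Rmult_integral in e; lra.
- set (P := fun t => ux 0 0 * sin t - uy 0 0 * cos t).
  transitivity (minus (P (2 * PI)) (P 0)).
  2: { unfold P, minus, plus, opp; simpl.
       rewrite cos_2PI, sin_2PI, cos_0, sin_0; ring. }
  apply (is_RInt_unique (V := R_CompleteNormedModule)).
  apply (is_RInt_ext (fun t => ux 0 0 * cos t + uy 0 0 * sin t)).
  { intros t _; rewrite !Rmult_0_l; symmetry; apply Rmult_1_r. }
  apply (is_RInt_derive P).
  + intros t _; unfold P; auto_derive; trivial; ring.
  + intros t _; apply continuous_combination.
Qed.

(** As [u >= 0] and [a cos t + b sin t <= 1], the first harmonic is at most the integral of [u]. The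
    factor 2 is the ratio of [2 PI] in the mean value to [PI] in the first harmonic; finally [r]
    tends to 1. *)
Lemma caratheodory (u v ux uy : R -> R -> R) (a b : R) :
  cauchy_riemann u v ux uy ->
  (forall x y, x ^ 2 + y ^ 2 < 1 -> 0 <= u x y) ->
  a ^ 2 + b ^ 2 <= 1 -> a * ux 0 0 + b * uy 0 0 <= 2 * u 0 0.
Proof.
intros CR pos hab.
assert (main : forall r, 0 < r < 1 -> r * (a * ux 0 0 + b * uy 0 0) <= 2 * u 0 0).
{ intros r hr.
  assert (h1 := circle_int_const _ _ _ _ r CR hr).
  assert (hk := circle_int_first_harmonic _ _ _ _ a b r CR hr).
  assert (c1 : forall t : R, continuous (fun _ : R => 1) t)
    by (intros; apply continuous_const).
  assert (e1 := ex_circle_int _ _ _ _ CR (fun _ => 1) r ltac:(lra) c1).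
  assert (ek := ex_circle_int _ _ _ _ CR _ r ltac:(lra) (continuous_combination a b)).
  assert (le : circle_int u (fun t => a * cos t + b * sin t) r <= circle_int u (fun _ => 1) r).
  { apply RInt_le; trivial; [generalize PI_RGT_0; lra|].
    intros t _; apply Rmult_le_compat_l.
    - apply pos, polar_in_disc; lra.
    - generalize (sin2_cos2 t); unfold Rsqr; intros e.
      assert (0 <= (a * sin t - b * cos t) ^ 2) by apply pow2_ge_0.
      assert ((a * cos t + b * sin t) ^ 2 + (a * sin t - b * cos t) ^ 2
        = (a ^ 2 + b ^ 2) * (sin t * sin t + cos t * cos t)) by ring.
      rewrite e in H0; nra. }
  rewrite h1, hk in le.
  apply (Rmult_le_reg_l PI); [apply PI_RGT_0 | lra]. }
set (c := a * ux 0 0 + b * uy 0 0) in *.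
destruct (Rle_or_lt c (2 * u 0 0)) as [|lt]; trivial.
assert (u0 : 0 <= u 0 0) by (apply pos; lra).
(* If [c > 2 u(0)], the midpoint [r] of [2 u(0) / c] and 1 still has [r c > 2 u(0)], against
   [main]. *)
assert (h := main ((1 + 2 * u 0 0 / c) / 2)).
assert (hq : 0 <= 2 * u 0 0 / c < 1).
{ split; [apply Rdiv_le_0_compat; lra | apply Rlt_div_l; lra]. }
specialize (h ltac:(lra)).
replace ((1 + 2 * u 0 0 / c) / 2 * c) with ((c + 2 * u 0 0) / 2) in h by (field; lra).
lra.
Qed.

(** * Quaternions and slices *)

Lemma quat_eq (a b c d a' b' c' d' : R) :
  a = a' -> b = b' -> c = c' -> d = d' -> (a, b, c, d) = (a', b', c', d') :> quat.
Proof. now intros -> -> -> ->. Qed.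

Lemma imag_unit_coords (a b c d : R) :
  imag_unit (a, b, c, d) <-> a = 0 /\ b ^ 2 + c ^ 2 + d ^ 2 = 1.
Proof.
unfold imag_unit, RtoH; simpl; split.
- intros e; injection e; intros e4 e3 e2 e1.
  (* The imaginary part of the square is [2 a (b, c, d)]; with [a <> 0] it would leave
     [a ^ 2 = -1]. *)
  assert (a = 0) by nra; subst; split; nra.
- intros [-> e]; apply quat_eq; nra.
Qed.

Lemma slice_pt_coords (a b c d x y : R) :
  slice_pt (a, b, c, d) x y = (x + y * a, y * b, y * c, y * d).
Proof.
transitivity ((x + y * a, 0 + y * b, 0 + y * c, 0 + y * d) : quat); [reflexivity|].
apply quat_eq; ring.
Qed.

Lemma unit_ball_coords (a b c d : R) :
  unit_ball (a, b, c, d) <-> a ^ 2 + b ^ 2 + c ^ 2 + d ^ 2 < 1.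
Proof.
unfold unit_ball, Hnorm; rewrite <- sqrt_1 at 1; split; intros h.
- now apply sqrt_lt_0_alt in h.
- apply sqrt_lt_1_alt; split; trivial; nra.
Qed.

Lemma unit_ball_slice (I : quat) (x y : R) : imag_unit I ->
  unit_ball (slice_pt I x y) <-> x ^ 2 + y ^ 2 < 1.
Proof.
destruct I as [[[a b] c] d]; intros h; apply imag_unit_coords in h as [-> h].
rewrite slice_pt_coords, unit_ball_coords.
replace ((x + y * 0) ^ 2 + (y * b) ^ 2 + (y * c) ^ 2 + (y * d) ^ 2)
  with (x ^ 2 + y ^ 2 * (b ^ 2 + c ^ 2 + d ^ 2)) by ring.
now rewrite h, Rmult_1_r.
Qed.

Lemma slice_pt_0 (I : quat) : RtoH 0 = slice_pt I 0 0.
Proof.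
destruct I as [[[a b] c] d]; rewrite slice_pt_coords; unfold RtoH; apply quat_eq; ring.
Qed.

Lemma quat_on_slice (q : quat) : exists I a b, imag_unit I /\ q = slice_pt I a b.
Proof.
destruct q as [[[n0 n1] n2] n3].
destruct (Req_dec (n1 ^ 2 + n2 ^ 2 + n3 ^ 2) 0) as [e|ne].
- exists (0, 1, 0, 0), n0, 0; rewrite slice_pt_coords, imag_unit_coords.
  split; [split; ring|].
  assert (n1 = 0) by nra; assert (n2 = 0) by nra; assert (n3 = 0) by nra; subst.
  apply quat_eq; ring.
- set (m := sqrt (n1 ^ 2 + n2 ^ 2 + n3 ^ 2)).
  assert (mp : 0 < m) by (apply sqrt_lt_R0; nra).
  assert (mm : m * m = n1 ^ 2 + n2 ^ 2 + n3 ^ 2) by (apply sqrt_sqrt; nra).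
  exists (0, n1 / m, n2 / m, n3 / m), n0, m; rewrite slice_pt_coords, imag_unit_coords.
  split; [split; trivial|].
  + replace ((n1 / m) ^ 2 + (n2 / m) ^ 2 + (n3 / m) ^ 2)
      with ((n1 ^ 2 + n2 ^ 2 + n3 ^ 2) / (m * m)) by (field; lra).
    rewrite mm; now field.
  + apply quat_eq; field; lra.
Qed.

Lemma Hdot_cauchy_schwarz (p q : quat) : Rabs (Hdot p q) <= Hnorm p * Hnorm q.
Proof.
destruct p as [[[a b] c] d], q as [[[e f] g] h]; unfold Hdot, Hnorm.
rewrite <- sqrt_mult_alt by nra.
rewrite <- sqrt_Rsqr_abs.
apply sqrt_le_1_alt; unfold Rsqr.
(* Lagrange's identity: this sum of squared minors is the difference of the two sides. *)
assert (0 <= (a * f - b * e) ^ 2 + (a * g - c * e) ^ 2 + (a * h - d * e) ^ 2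
  + (b * g - c * f) ^ 2 + (b * h - d * f) ^ 2 + (c * h - d * g) ^ 2)
  by (repeat apply Rplus_le_le_0_compat; apply pow2_ge_0).
nra.
Qed.

Lemma Hdot_plus (n p q : quat) : Hdot n (p + q)%H = Hdot n p + Hdot n q.
Proof.
destruct n as [[[n0 n1] n2] n3], p as [[[a b] c] d], q as [[[e f] g] h].
change (n0 * (a + e) + n1 * (b + f) + n2 * (c + g) + n3 * (d + h) =
  (n0 * a + n1 * b + n2 * c + n3 * d) + (n0 * e + n1 * f + n2 * g + n3 * h)); ring.
Qed.

Lemma Hdot_scal (n p : quat) (t : R) : Hdot n (Hscal t p) = t * Hdot n p.
Proof.
destruct n as [[[n0 n1] n2] n3], p as [[[a b] c] d].
change (n0 * (t * a) + n1 * (t * b) + n2 * (t * c) + n3 * (t * d) =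
  t * (n0 * a + n1 * b + n2 * c + n3 * d)); ring.
Qed.

Lemma Hdot_minus (n p q : quat) : Hdot n (p - q)%H = Hdot n p - Hdot n q.
Proof.
destruct n as [[[n0 n1] n2] n3], p as [[[a b] c] d], q as [[[e f] g] h].
change (n0 * (a + - e) + n1 * (b + - f) + n2 * (c + - g) + n3 * (d + - h) =
  (n0 * a + n1 * b + n2 * c + n3 * d) - (n0 * e + n1 * f + n2 * g + n3 * h)); ring.
Qed.

Lemma Hdot_linear (n : quat) : is_linear (fun q : quat => Hdot n q).
Proof.
split.
- apply Hdot_plus.
- intros t p; apply Hdot_scal.
- assert (pos : 0 <= Hnorm n)
    by (destruct n as [[[n0 n1] n2] n3]; apply sqrt_pos).
  (* The [+ 1] keeps the bound positive when [n] is zero, as [is_linear] demands. *)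
  exists (Hnorm n + 1); split; [lra|].
  intros q; rewrite <- (Hnorm_norm q).
  assert (posq : 0 <= Hnorm q)
    by (destruct q as [[[n0 n1] n2] n3]; apply sqrt_pos).
  change (Rabs (Hdot n q) <= (Hnorm n + 1) * Hnorm q).
  generalize (Hdot_cauchy_schwarz n q); nra.
Qed.

Lemma is_derive_Hdot (n : quat) (g : R -> quat) (x : R) (l : quat) :
  is_derive (g : R -> quat) x l -> is_derive (fun t => Hdot n (g t)) x (Hdot n l).
Proof.
intros d.
refine (filterdiff_ext_lin _ _ _ (filterdiff_comp' g (fun q => Hdot n q) x _ _ d
  (filterdiff_linear _ (Hdot_linear n))) _).
intros y; apply Hdot_scal.
Qed.

Lemma continuous_Hdot (n : quat) {U : UniformSpace} (g : U -> quat) (x : U) :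
  continuous g x -> continuous (fun t => Hdot n (g t)) x.
Proof.
intros c; apply (continuous_comp g (fun q => Hdot n q)); trivial.
exact (linear_cont _ _ (Hdot_linear n)).
Qed.

(** * Real parts of slice regular functions *)

(** The adjoint of left multiplication by [I] is left multiplication by its conjugate, which is
    [-I]. *)
Lemma Hdot_imag_mult (I n p : quat) : imag_unit I ->
  Hdot (I * n)%H p = - Hdot n (I * p)%H.
Proof.
destruct I as [[[a b] c] d]; intros h; apply imag_unit_coords in h as [-> _].
destruct n as [[[n0 n1] n2] n3], p as [[[p0 p1] p2] p3]; simpl; ring.
Qed.

Lemma Hdot_imag_mult2 (I n p : quat) : imag_unit I ->
  Hdot (I * (I * n))%H p = - Hdot n p.
Proof.
destruct I as [[[a b] c] d]; intros h; apply imag_unit_coords in h as [-> h].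
destruct n as [[[n0 n1] n2] n3], p as [[[p0 p1] p2] p3]; simpl.
transitivity (- (b ^ 2 + c ^ 2 + d ^ 2) * (n0 * p0 + n1 * p1 + n2 * p2 + n3 * p3));
  [ring | rewrite h; ring].
Qed.

Lemma Hdot_slice_pt (I : quat) (a b : R) : imag_unit I ->
  Hdot (slice_pt I a b) (RtoH 1) = a /\
  Hdot (I * slice_pt I a b)%H (RtoH 1) = - b /\
  Hdot (slice_pt I a b) (slice_pt I a b) = a ^ 2 + b ^ 2.
Proof.
destruct I as [[[i0 i1] i2] i3]; intros h; apply imag_unit_coords in h as [-> h].
rewrite slice_pt_coords; simpl; repeat split.
- ring.
- transitivity (- b * (i1 ^ 2 + i2 ^ 2 + i3 ^ 2)); [ring | rewrite h; ring].
- transitivity (a ^ 2 + b ^ 2 * (i1 ^ 2 + i2 ^ 2 + i3 ^ 2)); [ring | rewrite h; ring].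
Qed.

(** With [p] and [q] the partial derivatives of [f] on the slice of [I], these are the
    Cauchy-Riemann equations for the pair [<n, f>], [<I n, f>]. *)
Lemma slice_cauchy_riemann (I p q : quat) : imag_unit I ->
  Hscal (1 / 2) (p + I * q)%H = RtoH 0 ->
  forall n, Hdot n p = Hdot (I * n)%H q /\ Hdot (I * n)%H p = - Hdot n q.
Proof.
intros hI e.
assert (h : forall n, Hdot n p = Hdot (I * n)%H q).
{ intros n; assert (z : Hdot n (Hscal (1 / 2) (p + I * q)%H) = 0).
  { rewrite e; destruct n as [[[n0 n1] n2] n3]; simpl; ring. }
  rewrite Hdot_scal, Hdot_plus in z; rewrite Hdot_imag_mult by trivial; lra. }
intros n; split; [apply h|].
now rewrite h, Hdot_imag_mult2.
Qed.

Lemma slice_support_bound (f : quat -> quat) (n w : quat) :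
  slice_regular f -> is_slice_derive f (RtoH 0) (RtoH 1) -> Hdot n n = 1 ->
  (forall q, unit_ball q -> Hdot n w <= Hdot n (f q)) ->
  1 / 2 <= Hdot n (f (RtoH 0) - w)%H.
Proof.
intros reg der unit sup.
destruct (quat_on_slice n) as (I & a & b & hI & ->).
set (n := slice_pt I a b) in *.
destruct (Hdot_slice_pt I a b hI) as (e1 & e2 & e3); fold n in e1, e2, e3.
destruct (reg I hI) as (fx & fy & H).
destruct (der I 0 0 hI (slice_pt_0 I)) as (gx & gy & hx & hy & one).
assert (dx : forall m x y, x ^ 2 + y ^ 2 < 1 ->
  is_derive (fun t => Hdot m (f (slice_pt I t y))) x (Hdot m (fx (x, y)))).
{ intros m x y h; apply (is_derive_Hdot m (fun t => f (slice_pt I t y))).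
  now apply H, unit_ball_slice. }
assert (dy : forall m x y, x ^ 2 + y ^ 2 < 1 ->
  is_derive (fun t => Hdot m (f (slice_pt I x t))) y (Hdot m (fy (x, y)))).
{ intros m x y h; apply (is_derive_Hdot m (fun t => f (slice_pt I x t))).
  now apply H, unit_ball_slice. }
assert (cr : forall x y, x ^ 2 + y ^ 2 < 1 -> forall m,
  Hdot m (fx (x, y)) = Hdot (I * m)%H (fy (x, y)) /\
  Hdot (I * m)%H (fx (x, y)) = - Hdot m (fy (x, y))).
{ intros x y h; apply slice_cauchy_riemann; trivial; now apply H, unit_ball_slice. }
(* Regularity and the slice derivative each supply their own partial derivatives at 0; uniqueness of
   derivatives identifies them, one pairing with [m] at a time. *)
assert (ux0 : forall m, Hdot m (fx (0, 0)) = Hdot m gx).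
{ intros m; rewrite <- (is_derive_unique _ _ _ (dx m 0 0 ltac:(lra))).
  apply is_derive_unique; now apply (is_derive_Hdot m (fun t => f (slice_pt I t 0))). }
assert (uy0 : forall m, Hdot m (fy (0, 0)) = Hdot m gy).
{ intros m; rewrite <- (is_derive_unique _ _ _ (dy m 0 0 ltac:(lra))).
  apply is_derive_unique; now apply (is_derive_Hdot m (fun t => f (slice_pt I 0 t))). }
(* Since [fx + I fy = 0], the slice derivative [(fx - I fy) / 2] is just [fx]. *)
assert (d0 : forall m, Hdot m (RtoH 1) = Hdot m (fx (0, 0))).
{ intros m; rewrite one, Hdot_scal, Hdot_minus, <- ux0.
  destruct (cr 0 0 ltac:(lra) m) as [k _].
  generalize (Hdot_imag_mult I m gy hI); rewrite <- uy0; lra. }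
(* The weights [a], [b] are the gradient at 0 of the first function, so the left side of the
   inequality becomes [a ^ 2 + b ^ 2 = 1]. *)
assert (car := caratheodory
  (fun x y => Hdot n (f (slice_pt I x y)) - Hdot n w)
  (fun x y => Hdot (I * n)%H (f (slice_pt I x y)))
  (fun x y => Hdot n (fx (x, y))) (fun x y => Hdot n (fy (x, y))) a b).
cbv beta in car; rewrite <- slice_pt_0, <- d0, e1 in car.
destruct (cr 0 0 ltac:(lra) n) as [_ k]; rewrite <- d0, e2 in k.
rewrite Hdot_minus; cut (a * a + b * Hdot n (fy (0, 0))
  <= 2 * (Hdot n (f (RtoH 0)) - Hdot n w)).
{ replace (Hdot n (fy (0, 0))) with b by lra; lra. }
apply car; [| | lra].
- intros x y h; destruct (cr x y h n) as [k1 k2].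
  assert (B := proj2 (unit_ball_slice I x y hI) h).
  destruct (H x y B) as (_ & _ & cx & cy & _).
  cbv beta; rewrite <- k2; refine (conj _ (conj _ (conj _ (conj _ (conj _ _))))).
  + rewrite <- (Rminus_0_r (Hdot n (fx (x, y)))).
    apply (is_derive_minus (V := R_NormedModule) (fun t => Hdot n (f (slice_pt I t y)))
      (fun _ => Hdot n w) x _ 0); [now apply dx|].
    apply (is_derive_const (V := R_NormedModule)).
  + rewrite <- (Rminus_0_r (Hdot n (fy (x, y)))).
    apply (is_derive_minus (V := R_NormedModule) (fun t => Hdot n (f (slice_pt I x t)))
      (fun _ => Hdot n w) y _ 0); [now apply dy|].
    apply (is_derive_const (V := R_NormedModule)).
  + now apply dx.
  + rewrite k1; now apply dy.
  + apply (continuous_ext (fun z => Hdot n (fx z))); [now intros []|].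
    now apply continuous_Hdot.
  + apply (continuous_ext (fun z => Hdot n (fy z))); [now intros []|].
    now apply continuous_Hdot.
- intros x y h; cut (Hdot n w <= Hdot n (f (slice_pt I x y))); [lra|].
  now apply sup, unit_ball_slice.
Qed.

(** * Derivatives and continuity of maps into a slice *)

Lemma slice_pt_combination (I : quat) (x y : R) :
  slice_pt I x y = plus (scal x (RtoH 1)) (scal y I).
Proof.
destruct I as [[[a b] c] d]; rewrite slice_pt_coords; symmetry.
transitivity ((x * 1 + y * a, x * 0 + y * b, x * 0 + y * c, x * 0 + y * d) : quat);
  [reflexivity | apply quat_eq; ring].
Qed.

Lemma is_derive_slice_pt (I : quat) (g h : R -> R) (x l m : R) :
  is_derive g x l -> is_derive h x m ->
  is_derive (fun t => slice_pt I (g t) (h t) : quat) x (slice_pt I l m).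
Proof.
intros dg dh; rewrite slice_pt_combination.
apply (is_derive_ext (fun t => plus (scal (g t) (RtoH 1)) (scal (h t) I))).
- intros t; symmetry; apply slice_pt_combination.
- apply (is_derive_plus (fun t => scal (g t) (RtoH 1)) (fun t => scal (h t) I)).
  + exact (is_derive_scal_l g x l (RtoH 1) dg).
  + exact (is_derive_scal_l h x m I dh).
Qed.

Lemma continuous_slice_pt (I : quat) {U : UniformSpace} (g h : U -> R) (x : U) :
  continuous g x -> continuous h x ->
  continuous (fun t => slice_pt I (g t) (h t)) x.
Proof.
intros cg ch.
apply (continuous_ext (fun t => plus (scal (g t) (RtoH 1)) (scal (h t) I))).
- intros t; symmetry; apply slice_pt_combination.
- apply (continuous_plus (fun t => scal (g t) (RtoH 1)) (fun t => scal (h t) I));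
    [exact (continuous_scal_l g (RtoH 1) x cg) | exact (continuous_scal_l h I x ch)].
Qed.

(** * The extremal function *)

(* [q (1 - q)^-1], written as [(q - |q|^2) / |1 - q|^2]. *)
Definition cayley (q : quat) : quat :=
  let '(a, b, c, d) := q in
  let N := a ^ 2 + b ^ 2 + c ^ 2 + d ^ 2 in
  let D := 1 - 2 * a + N in
  ((a - N) / D, b / D, c / D, d / D).

(** With [cayley_im], the two parts of the complex function [z / (1 - z)]. *)
Definition cayley_re (x y : R) : R := (x - (x ^ 2 + y ^ 2)) / ((1 - x) ^ 2 + y ^ 2).
Definition cayley_im (x y : R) : R := y / ((1 - x) ^ 2 + y ^ 2).
(** With [cayley'_im], the two parts of the derivative [(1 - z)^-2], written with sums, products and
    one inverse so that the continuity rules apply to the terms as they stand. *)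
Definition cayley'_re (x y : R) : R :=
  ((1 - x) * (1 - x) + - (y * y)) * / (((1 - x) * (1 - x) + y * y) * ((1 - x) * (1 - x) + y * y)).
Definition cayley'_im (x y : R) : R :=
  2 * ((1 - x) * y) * / (((1 - x) * (1 - x) + y * y) * ((1 - x) * (1 - x) + y * y)).

(** [q (1 - q)^-1] involves real coefficients only, so it acts on every slice by the same complex
    function. *)
Lemma cayley_slice (I : quat) (x y : R) : imag_unit I ->
  cayley (slice_pt I x y) = slice_pt I (cayley_re x y) (cayley_im x y).
Proof.
destruct I as [[[i0 i1] i2] i3]; intros h; apply imag_unit_coords in h as [-> h].
rewrite !slice_pt_coords; unfold cayley, cayley_re, cayley_im.
replace ((x + y * 0) ^ 2 + (y * i1) ^ 2 + (y * i2) ^ 2 + (y * i3) ^ 2)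
  with (x ^ 2 + y ^ 2 * (i1 ^ 2 + i2 ^ 2 + i3 ^ 2)) by ring.
rewrite h.
replace (1 - 2 * (x + y * 0) + (x ^ 2 + y ^ 2 * 1)) with ((1 - x) ^ 2 + y ^ 2) by ring.
unfold Rdiv; apply quat_eq; ring.
Qed.

Lemma cayley_derivatives (I : quat) (x y : R) : imag_unit I -> x ^ 2 + y ^ 2 < 1 ->
  is_slice_dx cayley I x y (slice_pt I (cayley'_re x y) (cayley'_im x y)) /\
  is_slice_dy cayley I x y (slice_pt I (- cayley'_im x y) (cayley'_re x y)).
Proof.
intros hI h.
assert (pos : (1 - x) ^ 2 + y ^ 2 <> 0) by nra.
split.
- apply (is_derive_ext (fun t => slice_pt I (cayley_re t y) (cayley_im t y))).
  { intros t; symmetry; now apply cayley_slice. }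
  apply is_derive_slice_pt; unfold cayley_re, cayley_im, cayley'_re, cayley'_im;
    auto_derive; trivial; field; simpl in *; lra.
- apply (is_derive_ext (fun t => slice_pt I (cayley_re x t) (cayley_im x t))).
  { intros t; symmetry; now apply cayley_slice. }
  apply is_derive_slice_pt; unfold cayley_re, cayley_im, cayley'_re, cayley'_im;
    auto_derive; trivial; field; simpl in *; lra.
Qed.

Lemma cayley_regular : slice_regular cayley.
Proof.
intros I hI.
exists (fun z => slice_pt I (cayley'_re (fst z) (snd z)) (cayley'_im (fst z) (snd z))).
exists (fun z => slice_pt I (- cayley'_im (fst z) (snd z)) (cayley'_re (fst z) (snd z))).
intros x y B; apply unit_ball_slice in B; trivial.
destruct (cayley_derivatives I x y hI B) as [dx dy].
assert (cx : continuous (fun z : R * R => 1 - fst z) (x, y)).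
{ apply (continuous_minus (V := R_NormedModule));
    [apply continuous_const | apply continuous_fst2]. }
assert (cy := continuous_snd2 x y).
assert (cinv : continuous (fun z : R * R => / (((1 - fst z) * (1 - fst z) + snd z * snd z)
   * ((1 - fst z) * (1 - fst z) + snd z * snd z))) (x, y)).
{ apply (continuous_comp (fun z : R * R => ((1 - fst z) * (1 - fst z) + snd z * snd z)
    * ((1 - fst z) * (1 - fst z) + snd z * snd z)) Rinv).
  - repeat first [exact cx | exact cy | apply continuous_Rmult | apply continuous_Rplus].
  - apply continuous_Rinv; simpl; apply Rgt_not_eq.
    assert (0 < (1 - x) * (1 - x) + y * y) by nra; nra. }
assert (cre : continuous (fun z : R * R => cayley'_re (fst z) (snd z)) (x, y)).
{ apply continuous_Rmult; trivial; apply continuous_Rplus; [now apply continuous_Rmult|].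
  apply (continuous_opp (V := R_NormedModule)); now apply continuous_Rmult. }
assert (cim : continuous (fun z : R * R => cayley'_im (fst z) (snd z)) (x, y)).
{ apply continuous_Rmult; trivial; apply continuous_Rmult;
    [apply continuous_const | now apply continuous_Rmult]. }
refine (conj dx (conj dy (conj _ (conj _ _)))).
- now apply continuous_slice_pt.
- apply continuous_slice_pt; trivial; now apply (continuous_opp (V := R_NormedModule)).
(* The two derivatives are [P + Q I] and [-Q + P I], the second being [I] times the first;
   [I ^ 2 = -1] does the rest, whatever [P] and [Q] are. *)
- simpl; generalize (cayley'_re x y), (cayley'_im x y); intros P Q.
  destruct I as [[[i0 i1] i2] i3]; apply imag_unit_coords in hI as [-> h].
  rewrite !slice_pt_coords; simpl.
  match goal with |- Hscal _ (Hplus (?a, ?b, ?c, ?d) (?a', ?b', ?c', ?d')) = _ =>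
    transitivity ((1 / 2 * (a + a'), 1 / 2 * (b + b'), 1 / 2 * (c + c'), 1 / 2 * (d + d')) : quat)
  end; [reflexivity | apply quat_eq].
  + transitivity (1 / 2 * (P * (1 - (i1 ^ 2 + i2 ^ 2 + i3 ^ 2)))); [ring | rewrite h; ring].
  + ring.
  + ring.
  + ring.
Qed.

Lemma cayley_derive_0 : is_slice_derive cayley (RtoH 0) (RtoH 1).
Proof.
intros I x y hI e.
assert (z : x = 0 /\ y = 0).
{ destruct I as [[[i0 i1] i2] i3]; apply imag_unit_coords in hI as [-> h].
  rewrite slice_pt_coords in e; injection e; intros e3 e2 e1 e0.
  assert (y ^ 2 = (y * i1) ^ 2 + (y * i2) ^ 2 + (y * i3) ^ 2).
  { transitivity (y ^ 2 * (i1 ^ 2 + i2 ^ 2 + i3 ^ 2)); [rewrite h; ring | ring]. }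
  rewrite <- e1, <- e2, <- e3 in H; split; nra. }
destruct z as [-> ->].
destruct (cayley_derivatives I 0 0 hI ltac:(lra)) as [dx dy].
eexists; eexists; split; [exact dx | split; [exact dy|]].
replace (cayley'_re 0 0) with 1 by (unfold cayley'_re; field).
replace (cayley'_im 0 0) with 0 by (unfold cayley'_im; field).
destruct I as [[[i0 i1] i2] i3]; apply imag_unit_coords in hI as [-> h].
rewrite !slice_pt_coords; simpl; symmetry.
match goal with |- Hscal _ (Hminus (?a, ?b, ?c, ?d) (?a', ?b', ?c', ?d')) = _ =>
  transitivity ((1 / 2 * (a - a'), 1 / 2 * (b - b'), 1 / 2 * (c - c'), 1 / 2 * (d - d')) : quat)
end; [reflexivity | apply quat_eq].
- transitivity (1 / 2 * (1 + (i1 ^ 2 + i2 ^ 2 + i3 ^ 2))); [field | rewrite h; field].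
- ring.
- ring.
- ring.
Qed.

(** For [w = q (1 - q)^-1] one has [Re w + 1/2 = (1 - |q|^2) / (2 |1 - q|^2)], which is positive
    exactly when [|q| < 1], for [q <> 1]. *)
Lemma image_cayley (a b c d : R) :
  image cayley unit_ball (a, b, c, d) <-> - (1 / 2) < a.
Proof.
split.
- intros ([[[x y] z] t] & B & e); apply unit_ball_coords in B.
  unfold cayley in e; injection e; intros _ _ _ <-.
  assert (pos : 0 < 1 - 2 * x + (x ^ 2 + y ^ 2 + z ^ 2 + t ^ 2)) by nra.
  apply Rlt_div_r; trivial; nra.
- intros h; set (E := 1 + 2 * a + (a ^ 2 + b ^ 2 + c ^ 2 + d ^ 2)).
  assert (pos : 0 < E) by (unfold E; nra).
  (* The inverse map [w (1 + w)^-1], written as [(w + |w|^2) / |1 + w|^2] with [E = |1 + w|^2]. Then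
     [1 - q = (1 + w)^-1], so the denominator in [cayley] is [/ E]. *)
  exists ((a + (a ^ 2 + b ^ 2 + c ^ 2 + d ^ 2)) / E, b / E, c / E, d / E).
  set (M := a ^ 2 + b ^ 2 + c ^ 2 + d ^ 2) in *.
  assert (N : ((a + M) / E) ^ 2 + (b / E) ^ 2 + (c / E) ^ 2 + (d / E) ^ 2 = M / E).
  { transitivity ((M + 2 * a * M + M ^ 2) / (E * E)).
    - unfold M; field; lra.
    - replace (M + 2 * a * M + M ^ 2) with (M * E) by (unfold E; ring); field; lra. }
  split.
  + apply unit_ball_coords; rewrite N; apply Rlt_div_l; trivial; unfold E; lra.
  + unfold cayley; rewrite N.
    replace (1 - 2 * ((a + M) / E) + M / E) with (/ E)
      by (apply (Rmult_eq_reg_r E); [field_simplify; [unfold E; ring | lra | lra] | lra]).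
    apply quat_eq; field; lra.
Qed.

Lemma convex_image_cayley : convex_set (image cayley unit_ball).
Proof.
intros [[[a b] c] d] [[[a' b'] c'] d'] t h h' ht.
apply image_cayley in h, h'.
apply (image_cayley ((1 - t) * a + t * a') ((1 - t) * b + t * b')
  ((1 - t) * c + t * c') ((1 - t) * d + t * d')).
destruct (proj1 ht) as [pos | <-]; [|lra].
assert (0 < t * (a' + 1 / 2)) by (apply Rmult_lt_0_compat; lra).
assert (0 <= (1 - t) * (a + 1 / 2)) by (apply Rmult_le_pos; lra).
lra.
Qed.

Theorem theorem1p5 :
  (forall f : quat -> quat,
     slice_regular f ->
     convex_set (image f unit_ball) ->
     is_slice_derive f (RtoH 0) (RtoH 1) ->
     forall w : quat, Hball (f (RtoH 0)) (1 / 2) w -> image f unit_ball w) /\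
  (forall r : R, 1 / 2 < r ->
     ~ (forall f : quat -> quat,
          slice_regular f ->
          convex_set (image f unit_ball) ->
          is_slice_derive f (RtoH 0) (RtoH 1) ->
          forall w : quat, Hball (f (RtoH 0)) r w -> image f unit_ball w)).
Proof.
split.
- intros f reg conv der w hw; apply NNPP; intros nw.
  destruct (convex_separation _ w conv nw) as (n & unit & sup).
  assert (low := slice_support_bound f n w reg der unit
    (fun q B => sup (f q) (ex_intro _ q (conj B eq_refl)))).
  assert (n1 : Hnorm n = 1).
  { rewrite <- sqrt_1, <- unit; destruct n as [[[a b] c] d]; simpl; f_equal; ring. }
  assert (up := Hdot_cauchy_schwarz n (w - f (RtoH 0))%H).
  unfold Hball in hw; rewrite n1, Rmult_1_l in up.
  apply Rabs_le_between in up; rewrite Hdot_minus in up, low; lra.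
- intros r hr H.
  assert (c0 : cayley (RtoH 0) = RtoH 0).
  { apply quat_eq; field. }
  (* [-1/2] lies on the boundary of the half space, at distance exactly 1/2 from [cayley 0 = 0]: any
     [r > 1/2] would force it into the image. *)
  assert (out : image cayley unit_ball (RtoH (- (1 / 2)))).
  { apply (H cayley cayley_regular convex_image_cayley cayley_derive_0).
    rewrite c0; change (sqrt ((- (1 / 2) + - 0) ^ 2 + (0 + - 0) ^ 2 + (0 + - 0) ^ 2
      + (0 + - 0) ^ 2) < r).
    replace ((- (1 / 2) + - 0) ^ 2 + (0 + - 0) ^ 2 + (0 + - 0) ^ 2 + (0 + - 0) ^ 2)
      with (Rsqr (1 / 2)) by (unfold Rsqr; field).
    rewrite sqrt_Rsqr; lra. }
  apply image_cayley in out; lra.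
Qed.
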